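(* Let $q\geq 2$ be an integer, let $\rho\in(0,1-\frac{1}{q^2})$, and let $0<\varepsilon<H_{q^2}(\rho)$. For each positive integer $n$ let \[M(n,\rho,\varepsilon)=\left\lfloor q^{n\left(1-H_{q^2}(\rho)+\varepsilon+\frac1n\right)}\right\rfloor\] (so that $M(n,\rho,\varepsilon)\leq q^n$ for all sufficiently large $n$). Then \[\lim_{n\to\infty}\alpha_q\bigl(n,\rho,M(n,\rho,\varepsilon)\bigr)=1.\]
   Context: Let $G_q$ be a finite Abelian group of size $q$. For a positive integer $n$, $G_q^{n}$ is the set of vectors of length $n$ over $G_q$, and $G_q^{2\times n}$ is the set of $2\times n$ matrices over $G_q$, both with the entry-wise group operation. For a matrix $\mathbf{v}\in G_q^{2\times n}$, its $2$-weight $\mathrm{wt}^{(2)}(\mathbf{v})$ is the number of non-zero columns of $\mathbf{v}$, and the $2$-distance is $d^{(2)}(\mathbf{v},\mathbf{u})=\mathrm{wt}^{(2)}(\mathbf{u}-\mathbf{v})$. A code is a subset $C\subseteq G_q^n$. Let $C^2\subseteq G_q^{2\times n}$ be the set of $2\times n$ matrices both of whose rows belong to $C$ (the rows may be equal). The second covering radius of $C$ is \[R_2(C)=\max_{\mathbf{u}\in G_q^{2\times n}}\ \min_{\mathbf{c}\in C^2} d^{(2)}(\mathbf{c},\mathbf{u}),\] with the convention that $R_2(\emptyset)=\infty$. For an integer $0\leq M\leq q^n$, $\alpha_q(n,\rho,M)$ denotes the fraction, among all codes $C\subseteq G_q^n$ with $|C|=M$, of those with $R_2(C)\leq\rho n$: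 \[\alpha_q(n,\rho,M)=\frac{\bigl|\{C\subseteq G_q^n : |C|=M,\ R_2(C)\leq \rho n\}\bigr|}{\binom{q^n}{M}}.\] For an integer $Q\geq 2$, the $Q$-ary entropy function is $H_Q(x)=x\log_Q(Q-1)-x\log_Q(x)-(1-x)\log_Q(1-x)$, with $H_Q(0)=0$. *)

(* Defs.v *)
From HB Require Import structures.
From mathcomp Require Import all_boot all_order all_algebra.
From mathcomp Require Import all_classical all_reals all_analysis.

Set Implicit Arguments.
Unset Strict Implicit.
Unset Printing Implicit Defensive.

Import Order.TTheory GRing.Theory Num.Theory.
Import numFieldNormedType.Exports.

Local Open Scope ring_scope.

Definition wt2 (G : finZmodType) (n : nat) (v : 'M[G]_(2, n)) : nat :=
  #|[set j : 'I_n | col j v != 0]|.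

Definition d2 (G : finZmodType) (n : nat) (v u : 'M[G]_(2, n)) : nat :=
  wt2 (u - v).

Definition code2 (G : finZmodType) (n : nat) (C : {set 'rV[G]_n}) :
    {set 'M[G]_(2, n)} :=
  [set c : 'M[G]_(2, n) | [forall i : 'I_2, row i c \in C]].

(* The minimum over the empty set is +oo, so the empty code has radius +oo;
   the maximum is always over a nonempty set, so its unit -oo never shows. *)
Definition R2 (R : realType) (G : finZmodType) (n : nat)
    (C : {set 'rV[G]_n}) : \bar R :=
  \big[Order.max/-oo%E]_(u : 'M[G]_(2, n))
    \big[Order.min/+oo%E]_(c in code2 C) ((d2 c u)%:R)%:E.

(* The denominator is nonzero exactly when M <= #|G| ^ n. *)
Definition alpha (R : realType) (G : finZmodType) (n : nat) (rho : R)
    (M : nat) : R :=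
  #|[set C : {set 'rV[G]_n} |
      (#|C| == M) && (R2 R C <= (rho * n%:R)%:E)%E]|%:R
  / 'C(#|G| ^ n, M)%:R.

Definition logb (R : realType) (Q : nat) (x : R) : R := ln x / ln (Q%:R : R).

(* Since 0 * y = 0 for every y, this formula gives entropy Q 0 = 0. *)
Definition entropy (R : realType) (Q : nat) (x : R) : R :=
  x * logb Q (Q%:R - 1) - x * logb Q x - (1 - x) * logb Q (1 - x).

(* Only n > 0 is meaningful; [Num.truncn] is the floor of a nonnegative real. *)
Definition codesize (R : realType) (q n : nat) (rho eps : R) : nat :=
  Num.truncn ((q%:R : R) `^
    (n%:R * (1 - entropy (q ^ 2)%N rho + eps + n%:R^-1))).

Lemma entropy0 (R : realType) (Q : nat) : entropy Q (0 : R) = 0.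
Proof. by rewrite /entropy /logb !mul0r !subr0 ln1 mul0r mulr0 subr0. Qed.

Lemma R2_set0 (R : realType) (G : finZmodType) (n : nat) :
  R2 R (finset.set0 : {set 'rV[G]_n}) = +oo%E.
Proof.
have code2_0 : code2 (finset.set0 : {set 'rV[G]_n}) = finset.set0.
  apply/finset.setP => c; rewrite !inE; apply/negbTE/forallPn.
  by exists ord0; rewrite inE.
by rewrite /R2 (bigD1 (0 : 'M[G]_(2, n)))//= code2_0 big_set0 maxye.
Qed.

(* Main.v *)
Require Import Defs.
From HB Require Import structures.
From mathcomp Require Import all_boot all_order all_algebra all_fingroup.
From mathcomp Require Import all_classical all_reals all_analysis.
From mathcomp Require Import ring lra.

Set Implicit Arguments.
Unset Strict Implicit.
Unset Printing Implicit Defensive.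

Import Order.TTheory GRing.Theory Num.Theory.
Import numFieldNormedType.Exports.

Local Open Scope ring_scope.

(** The proof is probabilistic.  Fix a matrix [u].  A random code with about
[q ^ (n (1 - H + eps))] words contains on average about [q ^ (2 n eps)] pairs
of words within distance [rho n] of [u], where [H] is the entropy at [rho].  A
second-moment computation shows that at least one such pair is present except
with exponentially small probability.  The danger in such a computation is
that a few words lie in unusually many good pairs.  It is avoided by counting
only typical pairs: pairs whose columns look like independent samples of the
law that is zero with probability [1 - r], with [r] slightly below [rho], and
uniform among the nonzero columns otherwise ([typical_weight]).  A typical
single word then lies in a share of at most about [q ^ (- n H)] of the total
weight, because the entropy of a pair is at most twice that of one component
([joint_entropy_le]), and this share stays small when multiplied by the
sampling ratio [q ^ (n (H - eps))].  So the variance is negligible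
([second_moment], [miss_count]).

The resulting failure probability, of order [q ^ (- n eps / 2)], is too large
for a union bound over the [q ^ (2 n)] matrices [u].  The code is therefore
split into a constant number [K] of independent chunks, each of which still
has the right exponential size: all chunks fail together with the [K]-th power
of that probability, and [K eps >= 6] suffices ([alpha_ge],
[alpha_ge_geometric]).

Independence holds for words of letters drawn with replacement, whereas the
theorem is about uniform subsets.  As the covering property is inherited by
larger codes, an averaging over permutations of the alphabet shows that a
uniform subset fails at most as often as a uniform word of no more letters
([bad_subsets_le_bad_words]).  *)

(** * Moments of independent letters *)

(** The expectation of [g] at a family of independent letters of law [p]. *)
Definition iidE (R : realType) (I S : finType) (p : S -> R)
    (g : {ffun I -> S} -> R) : R :=
  \sum_(z : {ffun I -> S}) (\prod_i p (z i)) * g z.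

Lemma iidE_prod (R : realType) (I S : finType) (p : S -> R) (g : I -> S -> R) :
  iidE p (fun z : {ffun I -> S} => \prod_i g i (z i)) =
  \prod_i \sum_s p s * g i s.
Proof.
rewrite bigA_distr_bigA /iidE; apply: eq_bigr => z _.
by rewrite -big_split.
Qed.

Lemma eq_iidE (R : realType) (I S : finType) (p : S -> R)
    (g1 g2 : {ffun I -> S} -> R) : g1 =1 g2 -> iidE p g1 = iidE p g2.
Proof. by move=> e; apply: eq_bigr => z _; rewrite e. Qed.

Lemma iidEZ (R : realType) (I S : finType) (p : S -> R)
    (c : R) (g : {ffun I -> S} -> R) :
  iidE p (fun z => c * g z) = c * iidE p g.
Proof. by rewrite /iidE mulr_sumr; apply: eq_bigr => z _; rewrite mulrCA. Qed.

Lemma iidE_sum (R : realType) (I S J : finType) (p : S -> R)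
    (g : J -> {ffun I -> S} -> R) :
  iidE p (fun z => \sum_j g j z) = \sum_j iidE p (g j).
Proof.
rewrite /iidE exchange_big; apply: eq_bigr => z _; exact: mulr_sumr.
Qed.

Lemma iidED (R : realType) (I S : finType) (p : S -> R)
    (g1 g2 : {ffun I -> S} -> R) :
  iidE p (fun z => g1 z + g2 z) = iidE p g1 + iidE p g2.
Proof.
by rewrite /iidE -big_split; apply: eq_bigr => z _; rewrite mulrDr.
Qed.

Lemma ler_iidE (R : realType) (I S : finType) (p : S -> R)
    (g1 g2 : {ffun I -> S} -> R) :
  (forall s, 0 <= p s) -> (forall z, g1 z <= g2 z) ->
  iidE p g1 <= iidE p g2.
Proof.
move=> p0 le; apply: ler_sum => z _.
by apply: ler_wpM2l; [exact: prodr_ge0 | exact: le].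
Qed.

Lemma iidE_cst (R : realType) (I S : finType) (p : S -> R) (c : R) :
  \sum_s p s = 1 -> iidE p (fun _ : {ffun I -> S} => c) = c.
Proof.
move=> p1; rewrite -[RHS]mulr1.
transitivity (c * iidE p (fun z : {ffun I -> S} => \prod_(i : I) 1)).
  by rewrite -iidEZ; apply: eq_iidE => z; rewrite big1 ?mulr1.
rewrite (iidE_prod (I:=I) p (fun _ _ => 1)); congr (_ * _); apply: big1 => i _.
by under eq_bigr do rewrite mulr1.
Qed.

Lemma iidE1 (R : realType) (I S : finType) (p : S -> R) (f : S -> R) (i : I) :
  \sum_s p s = 1 ->
  iidE p (fun z : {ffun I -> S} => f (z i)) = \sum_s p s * f s.
Proof.
move=> p1.
rewrite (@eq_iidE _ _ _ _ _ (fun z : {ffun I -> S} =>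
   \prod_k (if k == i then f (z k) else 1))); last first.
  by move=> z; rewrite -big_mkcond big_pred1_eq.
rewrite (iidE_prod (I:=I) p (fun k s => if k == i then f s else 1)).
rewrite (bigD1 i) //= eqxx [X in _ * X]big1 ?mulr1 // => k /negbTE ->.
by under eq_bigr do rewrite mulr1.
Qed.

Lemma iidE2 (R : realType) (I S : finType) (p : S -> R) (f : S -> R)
    (i j : I) :
  \sum_s p s = 1 -> i != j ->
  iidE p (fun z : {ffun I -> S} => f (z i) * f (z j)) = (\sum_s p s * f s) ^+ 2.
Proof.
move=> p1 ij; have ji : j != i by rewrite eq_sym.
rewrite (@eq_iidE _ _ _ _ _ (fun z : {ffun I -> S} =>
   \prod_k (if (k == i) || (k == j) then f (z k) else 1))); last first.
  move=> z; rewrite -big_mkcond (bigD1 i) ?eqxx//= (big_pred1 j)// => k.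
  by case: eqVneq => [->|_]; rewrite /= ?andbT ?andbF // eq_sym (negbTE ji).
rewrite (iidE_prod (I:=I) p (fun k s => if (k == i) || (k == j) then f s else 1)).
rewrite (bigD1 i) //= (bigD1 j) //= !eqxx orbT.
rewrite [X in _ * (_ * X)]big1 ?mulr1 ?expr2 //.
move=> k /andP[/negbTE -> /negbTE ->] /=.
by under eq_bigr do rewrite mulr1.
Qed.

(** The square expands into pairs of indices: the [#|I|] diagonal pairs give a
second moment, and independence makes every other pair give the square of the
mean.  All variance estimates below come from this identity. *)
Lemma iidE_sqr_sum (R : realType) (I S : finType) (p : S -> R) (f : S -> R) :
  \sum_s p s = 1 ->
  iidE p (fun z : {ffun I -> S} => (\sum_i f (z i)) ^+ 2) =
  (#|I|%:R ^+ 2 - #|I|%:R) * (\sum_s p s * f s) ^+ 2 +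
  #|I|%:R * \sum_s p s * f s ^+ 2.
Proof.
move=> p1; set e := \sum_s _; set e2 := \sum_s _.
have -> : (fun z : {ffun I -> S} => (\sum_i f (z i)) ^+ 2) =
  (fun z => \sum_i \sum_j f (z i) * f (z j)).
  apply/funext => z; rewrite expr2 mulr_suml; apply: eq_bigr => i _.
  exact: mulr_sumr.
rewrite iidE_sum.
under eq_bigr => i _ do rewrite iidE_sum (bigD1 i)//=.
rewrite big_split /= addrC; congr (_ + _).
  under eq_bigr => i _.
    under eq_bigr => j ji do rewrite iidE2 // 1?eq_sym // -/e.
    rewrite sumr_const.
    have -> : #|[pred j | j != i]| = #|I|.-1 by rewrite cardC1.
  over.
  rewrite sumr_const.
  have [->|I0] := eqVneq #|I| 0%N; first by rewrite !mulr0n expr0n subr0 mul0r.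
  rewrite -mulrnA -[LHS]mulr_natl natrM.
  have -> : (#|I|.-1)%:R = #|I|%:R - 1 :> R.
    by rewrite -subn1 natrB// lt0n.
  by congr (_ * _); ring.
under eq_bigr => i _.
  rewrite (@eq_iidE _ _ _ _ _ (fun z : {ffun I -> S} => f (z i) ^+ 2)) //.
  rewrite (@iidE1 _ _ _ p (fun s => f s ^+ 2)) // -/e2.
over.
by rewrite sumr_const mulr_natl.
Qed.

(** Chebyshev's inequality for sums of independent letters: after centering,
only the diagonal part of [iidE_sqr_sum] survives. *)
Lemma iid_upper_tail (R : realType) (I S : finType) (p : S -> R) (f : S -> R)
    (e d : R) :
  (forall s, 0 <= p s) -> \sum_s p s = 1 -> \sum_s p s * f s = e ->
  (0 < #|I|)%N -> 0 < d ->
  iidE p (fun z : {ffun I -> S} =>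
     (#|I|%:R * (e + d) < \sum_i f (z i))%R%:R) <=
  (\sum_s p s * (f s - e) ^+ 2) / d ^+ 2 / #|I|%:R.
Proof.
move=> p0 p1 fe I0 d0; have n0 : 0 < #|I|%:R :> R by rewrite ltr0n.
have e0 : \sum_s p s * (f s - e) = 0.
  under eq_bigr do rewrite mulrBr.
  by rewrite sumrB -mulr_suml p1 mul1r fe subrr.
rewrite ler_pdivlMr // ler_pdivlMr ?exprn_gt0 //.
rewrite -(ler_pM2l n0).
have := iidE_sqr_sum I (fun s => f s - e) p1; rewrite e0 expr0n mulr0 add0r.
move=> <-.
set E := iidE _ _; rewrite (_ : _ * _ = (#|I|%:R * (#|I|%:R * d ^+ 2)) * E); last by ring.
rewrite /E -iidEZ {E}.
apply: ler_iidE => // z.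
have -> : \sum_i (f (z i) - e) = (\sum_i f (z i)) - #|I|%:R * e.
  by rewrite sumrB sumr_const mulr_natl.
case: ltP => [lt|_]; last by rewrite mulr0 sqr_ge0.
rewrite mulr1.
have h : #|I|%:R * d <= (\sum_i f (z i)) - #|I|%:R * e by lra.
have h0 : 0 <= #|I|%:R * d by rewrite mulr_ge0 // ltW.
suff -> : #|I|%:R * (#|I|%:R * d ^+ 2) = (#|I|%:R * d) ^+ 2.
  by rewrite ler_sqr ?nnegrE //; exact: le_trans h.
by ring.
Qed.

(** * A random chunk contains a good pair *)

Definition unif (R : realType) (S : finType) : S -> R := fun=> #|S|%:R^-1.

Lemma iidE_unif (R : realType) (I S : finType) (g : {ffun I -> S} -> R) :
  iidE (@unif R S) g = #|S|%:R ^- #|I| * \sum_z g z.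
Proof.
rewrite /iidE mulr_sumr; apply: eq_bigr => z _; congr (_ * _).
by rewrite prodr_const exprVn.
Qed.

(** The variance of the total weight of the [m ^ 2] pairs formed by [m] first
and [m] second components.  Two pairs are correlated only when they share a
component.  The pairs sharing exactly one contribute the [m ^ 3] term, which
the row and column sums control; the equal ones contribute the [m ^ 2] term,
which the maximum of [W] controls.  The proof applies [iidE_sqr_sum] to the
second components with the first ones fixed, then to the first components. *)
Lemma second_moment (R : realType) (X : finType) (m : nat) (W : X -> X -> R)
    (b S : R) :
  (0 < #|X|)%N ->
  (forall x y, 0 <= W x y) -> (forall x y, W x y <= b ^+ 2) ->
  (forall x, \sum_y W x y <= b) -> (forall y, \sum_x W x y <= b) ->
  \sum_x \sum_y W x y = S ->
  iidE (@unif R X) (fun xs : {ffun 'I_m -> X} =>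
    iidE (@unif R X) (fun ys : {ffun 'I_m -> X} =>
    (\sum_i \sum_j W (xs i) (ys j) - m%:R ^+ 2 * S / #|X|%:R ^+ 2) ^+ 2))
  <= 2 * m%:R ^+ 3 * b * S / #|X|%:R ^+ 3 + m%:R ^+ 2 * b ^+ 2 * S / #|X|%:R ^+ 2.
Proof.
move=> X0 W0 Wb rowb colb WS; set u := @unif R X.
set N : R := #|X|%:R; set M : R := m%:R.
have N0 : 0 < N by rewrite ltr0n.
have Nn : N != 0 by rewrite gt_eqF.
have M0 : 0 <= M by rewrite ler0n.
have u0 x : 0 <= u x by rewrite invr_ge0 ltW.
have u1 : \sum_x u x = 1.
  by rewrite sumr_const -[LHS]mulr_natl divff.
have b0 : 0 <= b.
  have /card_gt0P[x _] := X0.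
  by apply: le_trans (rowb x); apply: sumr_ge0.
pose f x := \sum_y u y * W x y.
pose g y := \sum_x u x * W x y.
have f0 x : 0 <= f x by apply: sumr_ge0 => y _; rewrite mulr_ge0.
have g0 y : 0 <= g y by apply: sumr_ge0 => x _; rewrite mulr_ge0.
have fb x : f x <= b / N.
  by rewrite /f -mulr_sumr mulrC ler_wpM2r ?invr_ge0 // ltW.
have gb y : g y <= b / N.
  by rewrite /g -mulr_sumr mulrC ler_wpM2r ?invr_ge0 // ltW.
have fS : \sum_x u x * f x = S / N ^+ 2.
  rewrite -mulr_sumr /f; under eq_bigr do rewrite -mulr_sumr.
  by rewrite -mulr_sumr WS /u /unif -/N; field.
have gS : \sum_x u x * g x = S / N ^+ 2.
  rewrite -mulr_sumr /g; under eq_bigr do rewrite -mulr_sumr.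
  by rewrite -mulr_sumr exchange_big WS /u /unif -/N; field.
have sqle (h : X -> R) c : (forall x, 0 <= h x) -> (forall x, h x <= c) ->
    \sum_x u x * h x ^+ 2 <= c * \sum_x u x * h x.
  move=> h0 hc; rewrite mulr_sumr; apply: ler_sum => x _.
  by rewrite expr2 mulrCA ler_wpM2r // mulr_ge0.
set mu := _ / _.
have eZ (xs : {ffun 'I_m -> X}) :
    iidE u (fun ys : {ffun 'I_m -> X} => \sum_i \sum_j W (xs i) (ys j)) =
    M * \sum_i f (xs i).
  rewrite iidE_sum mulr_sumr; apply: eq_bigr => i _.
  rewrite iidE_sum.
  under eq_bigr do rewrite (@iidE1 _ _ _ u (W (xs i))) //.
  by rewrite sumr_const card_ord -[LHS]mulr_natl.
have EZ : iidE u (fun xs : {ffun 'I_m -> X} => iidE u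
    (fun ys : {ffun 'I_m -> X} => \sum_i \sum_j W (xs i) (ys j))) = mu.
  rewrite (eq_iidE _ eZ) iidEZ iidE_sum.
  under eq_bigr do rewrite (@iidE1 _ _ _ u f) // fS.
  by rewrite sumr_const card_ord -[X in _ * X = _]mulr_natl /mu -/M; ring.
have eZ2 (xs : {ffun 'I_m -> X}) : iidE u (fun ys : {ffun 'I_m -> X} =>
      (\sum_i \sum_j W (xs i) (ys j)) ^+ 2) =
    (M ^+ 2 - M) * (\sum_i f (xs i)) ^+ 2 +
    M * \sum_y u y * (\sum_i W (xs i) y) ^+ 2.
  under eq_iidE => ys do rewrite exchange_big /=.
  rewrite (iidE_sqr_sum _ (fun y => \sum_i W (xs i) y)) // card_ord -/M.
  congr (_ * _ ^+ 2 + _).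
  by under eq_bigr do rewrite mulr_sumr; rewrite exchange_big.
have EZ2 : iidE u (fun xs : {ffun 'I_m -> X} => iidE u
    (fun ys : {ffun 'I_m -> X} => (\sum_i \sum_j W (xs i) (ys j)) ^+ 2)) <=
    mu ^+ 2 + (2 * M ^+ 3 * b * S / N ^+ 3 + M ^+ 2 * b ^+ 2 * S / N ^+ 2).
  rewrite (eq_iidE _ eZ2) iidED !iidEZ iidE_sum iidE_sqr_sum // card_ord -/M.
  rewrite fS.
  under [X in _ + _ * X <= _]eq_bigr => y _.
    rewrite iidEZ (@iidE_sqr_sum _ _ _ u (W^~ y)) // card_ord -/M -/(g y).
    over.
  have MM : 0 <= M ^+ 2 - M.
    rewrite subr_ge0 /M -natrX ler_nat; case: (m) => // k.
    by rewrite expnS leq_pmulr // expn_gt0.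
  have MM2 : M ^+ 2 - M <= M ^+ 2 by rewrite lerBlDr lerDl.
  have S0 : 0 <= S by rewrite -WS; apply: sumr_ge0 => x _; apply: sumr_ge0.
  have F : \sum_s u s * f s ^+ 2 <= b / N * (S / N ^+ 2).
    by rewrite -fS; exact: sqle.
  have G : \sum_s u s * g s ^+ 2 <= b / N * (S / N ^+ 2).
    by rewrite -gS; exact: sqle.
  have H : \sum_y u y * \sum_x u x * W x y ^+ 2 <= b ^+ 2 * (S / N ^+ 2).
    rewrite -gS mulr_sumr; apply: ler_sum => y _.
    by rewrite [leRHS]mulrCA; apply: ler_wpM2l => //; exact: sqle.
  have -> : \sum_y u y * ((M ^+ 2 - M) * g y ^+ 2 +
      M * \sum_s u s * W s y ^+ 2) =
      (M ^+ 2 - M) * (\sum_s u s * g s ^+ 2) +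
      M * \sum_y u y * \sum_x u x * W x y ^+ 2.
    rewrite !mulr_sumr -big_split; apply: eq_bigr => y _ /=; ring.
  set F0 := \sum_s _ in F *; set G0 := \sum_s _ in G *.
  set H0 := \sum_y _ in H *.
  have F00 : 0 <= F0 by apply: sumr_ge0 => x _; rewrite mulr_ge0 // sqr_ge0.
  have G00 : 0 <= G0 by apply: sumr_ge0 => x _; rewrite mulr_ge0 // sqr_ge0.
  have S'0 : 0 <= S / N ^+ 2 by rewrite divr_ge0 // exprn_ge0 // ltW.
  set T := S / N ^+ 2 in F G H S'0 *.
  have -> : mu = M ^+ 2 * T by rewrite /mu /T -/M; ring.
  have -> : 2 * M ^+ 3 * b * S / N ^+ 3 = M ^+ 3 * (b / N * T) + M ^+ 3 * (b / N * T).
    by rewrite /T; field.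
  have -> : M ^+ 2 * b ^+ 2 * S / N ^+ 2 = M ^+ 2 * (b ^+ 2 * T).
    by rewrite /T; ring.
  rewrite !mulrDr !addrA; repeat apply: lerD.
  - rewrite (_ : (M ^+ 2 * T) ^+ 2 = M ^+ 2 * (M ^+ 2 * T ^+ 2)); last by ring.
    apply: ler_pM => //; last by rewrite ler_wpM2r ?sqr_ge0.
    by rewrite mulr_ge0 ?sqr_ge0.
  - rewrite mulrA (_ : M ^+ 3 = M ^+ 2 * M); last by ring.
    by apply: ler_pM => //; [exact: mulr_ge0|rewrite ler_wpM2r].
  - rewrite [M * (_ * G0)]mulrA (_ : M ^+ 3 = M * M ^+ 2); last by ring.
    by apply: ler_pM; rewrite ?mulr_ge0 ?ler_wpM2l.
  - by rewrite [leLHS]mulrA -expr2 ler_wpM2l // sqr_ge0.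
rewrite -(lerD2l (mu ^+ 2)); apply: le_trans EZ2.
rewrite le_eqVlt; apply/orP; left; apply/eqP.
have center (xs : {ffun 'I_m -> X}) :
    iidE u (fun ys : {ffun 'I_m -> X} =>
      (\sum_i \sum_j W (xs i) (ys j) - mu) ^+ 2) =
    iidE u (fun ys : {ffun 'I_m -> X} =>
      (\sum_i \sum_j W (xs i) (ys j)) ^+ 2) +
    (- (2 * mu)) * iidE u (fun ys : {ffun 'I_m -> X} =>
      \sum_i \sum_j W (xs i) (ys j)) + mu ^+ 2.
  rewrite -[X in _ = _ + X](iidE_cst 'I_m (mu ^+ 2) u1) -iidEZ -!iidED.
  by apply: eq_iidE => ys; ring.
by rewrite (eq_iidE _ center) !iidED iidEZ iidE_cst // EZ; ring.
Qed.

(** If all weights vanish, the total weight is at distance [mu] from its mean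
[mu], so the variance bound of [second_moment] divided by [mu ^ 2] bounds the
probability of this event.  The bounds [b ^ 2] on weights and [b] on marginals
are matched: both error terms are then governed by the single quantity
[t = #|X| / m * b]. *)
Lemma miss_count (R : realType) (X : finType) (m : nat) (W : X -> X -> R)
    (b : R) :
  (0 < #|X|)%N -> (0 < m)%N ->
  (forall x y, 0 <= W x y) -> (forall x y, W x y <= b ^+ 2) ->
  (forall x, \sum_y W x y <= b) -> (forall y, \sum_x W x y <= b) ->
  2^-1 <= \sum_x \sum_y W x y ->
  #|[set w : {ffun 'I_m -> X} * {ffun 'I_m -> X} |
     [forall i, forall j, W (w.1 i) (w.2 j) == 0]]|%:R <=
  6 * (#|X|%:R / m%:R * b) * (#|X|%:R ^+ m) ^+ 2.
Proof.
move=> X0 m0 W0 Wb rowb colb; set S := \sum_x _ => S2.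
set miss := [set w | _].
have N0 : 0 < #|X|%:R :> R by rewrite ltr0n.
have M0 : 0 < m%:R :> R by rewrite ltr0n.
have b0 : 0 <= b.
  have /card_gt0P[x _] := X0.
  by apply: le_trans (rowb x); apply: sumr_ge0.
have := second_moment m X0 W0 Wb rowb colb (erefl S).
set N : R := #|X|%:R in N0 *; set M : R := m%:R in M0 *.
set t := N / M * b; set mu := _ / _; set E := iidE _ _ => EV.
have t0 : 0 <= t by rewrite mulr_ge0 // divr_ge0 // ltW.
have NM0 : 0 < (N ^+ m) ^+ 2 by rewrite !exprn_gt0.
have missN : #|miss|%:R <= (N ^+ m) ^+ 2.
  rewrite -!natrX ler_nat (leq_trans (max_card _)) //.
  by rewrite card_prod card_ffun card_ord mulnn.
have [t1|t1] := leP 1 t.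
  (* When 1 <= t the bound exceeds the number of all pairs of words. *)
  apply: (le_trans missN); rewrite ler_peMl // ?ltW //; lra.
have Emiss : mu ^+ 2 * #|miss|%:R / (N ^+ m) ^+ 2 <= E.
  rewrite /E iidE_unif card_ord ler_pdivrMr //.
  under eq_bigr do rewrite iidE_unif card_ord.
  rewrite -mulr_sumr; set s := \sum_z _.
  rewrite (_ : _ * (_ * s) * _ = s); last first.
    by rewrite -/N; field; rewrite expf_neq0 // gt_eqF.
  rewrite /s {s}.
  rewrite pair_big /= mulr_natr -sumr_const [leLHS]big_mkcond.
  apply: ler_sum => -[xs ys] _ /=; case: ifP => [|_]; last exact: sqr_ge0.
  rewrite inE /= => /forallP miss_xy.
  rewrite [X in X - _]big1 ?sub0r ?sqrrN // => i _.
  by rewrite big1 // => j _; apply/eqP; have /forallP := miss_xy i.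
have S0 : 0 < S by lra.
have mu0 : 0 < mu ^+ 2.
  by rewrite exprn_gt0 // !(mulr_gt0, invr_gt0, exprn_gt0).
have := le_trans Emiss EV.
have -> : 2 * M ^+ 3 * b * S / N ^+ 3 + M ^+ 2 * b ^+ 2 * S / N ^+ 2 =
   mu ^+ 2 * ((2 * t + t ^+ 2) / S).
  by rewrite /mu /t; field; rewrite !gt_eqF.
rewrite -mulrA ler_pM2l // ler_pdivrMr // => /le_trans; apply.
rewrite ler_pM2r // ler_pdivrMr //.
have tt : t ^+ 2 <= t by rewrite expr2 ler_piMl // ltW.
have : 6 * t * 2^-1 <= 6 * t * S by rewrite ler_wpM2l //; lra.
lra.
Qed.

(** * From random words to random subsets *)

(** Glue the canonical enumerations of [A] and [B] with those of their
complements. *)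
Lemma perm_imset_eq_card (X : finType) (A B : {set X}) :
  #|A| = #|B| -> exists s : {perm X}, [set s x | x in A]%SET = B.
Proof.
move=> eAB.
have eAC : #|~: A| = #|~: B|.
  by rewrite [LHS]cardsCs [RHS]cardsCs !finset.setCK eAB.
pose f x := if x \in A then nth x (enum B) (index x (enum A))
            else nth x (enum (~: B)) (index x (enum (~: A))).
have fA x : x \in A -> f x \in B.
  move=> xA; rewrite /f xA -mem_enum mem_nth // -cardE -eAB cardE index_mem.
  by rewrite mem_enum.
have fC x : x \notin A -> f x \notin B.
  move=> xA; rewrite /f (negbTE xA) -finset.in_setC -mem_enum mem_nth //.
  by rewrite -cardE -eAC cardE index_mem mem_enum finset.in_setC.
have inj : injective f.
  move=> x y; case: (boolP (x \in A)) (fA x) (fC x) => xA fx fx';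
  case: (boolP (y \in A)) (fA y) (fC y) => yA fy fy' e.
  - move: e; rewrite /f xA yA (set_nth_default x).
      move/eqP; rewrite nth_uniq ?enum_uniq //.
      - move=> /eqP; by apply: (@index_inj _ x); rewrite ?mem_enum.
      - by rewrite -cardE -eAB cardE index_mem mem_enum.
      - by rewrite -cardE -eAB cardE index_mem mem_enum.
    by rewrite -cardE -eAB cardE index_mem mem_enum.
  - by have := fy' isT; rewrite -e fx.
  - by have := fx' isT; rewrite e fy.
  - move: e; rewrite /f (negbTE xA) (negbTE yA) (set_nth_default x).
      move/eqP; rewrite nth_uniq ?enum_uniq //.
      - move=> /eqP; by apply: (@index_inj _ x); rewrite ?mem_enum ?finset.in_setC.
      - by rewrite -cardE -eAC cardE index_mem mem_enum finset.in_setC.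
      - by rewrite -cardE -eAC cardE index_mem mem_enum finset.in_setC.
    by rewrite -cardE -eAC cardE index_mem mem_enum finset.in_setC.
exists (perm inj); apply/eqP; rewrite eqEcard; apply/andP; split.
  by apply/fintype.subsetP => _ /imsetP[x xA ->]; rewrite permE fA.
by rewrite card_imset ?eAB //; exact: perm_inj.
Qed.

(** The image of [A] under a uniformly random permutation is a uniformly random
set of the size of [A]; here this is cleared of denominators.  Both sides
count the pairs of a permutation and a set of that size which it sends to a
bad set. *)
Lemma permuted_bad_count (X : finType) (bad : {set X} -> bool) (A : {set X}) :
  (#|[set C : {set X} | (#|C| == #|A|) && bad C]%SET| * #|{perm X}| =
   #|[set s : {perm X} | bad [set s x | x in A]]%SET| * 'C(#|X|, #|A|))%N.
Proof.
pose img (s : {perm X}) (C : {set X}) : {set X} := [set s x | x in C]%SET.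
have cimg s C : #|img s C| = #|C| by rewrite card_imset //; exact: perm_inj.
have imgK (s : {perm X}) : cancel (img s) (img s^-1%g).
  move=> C; rewrite /img -imset_comp -[RHS]imset_id; apply: eq_imset => x /=.
  by rewrite permK.
have imgM (s t : {perm X}) C : img (s * t)%g C = img t (img s C).
  by rewrite /img -imset_comp; apply: eq_imset => x; rewrite permM.
transitivity
  (\sum_(s : {perm X}) \sum_(C : {set X} | #|C| == #|A|) bad (img s C))%N.
  (* For a fixed permutation s, every bad set is the image of exactly one set. *)
  rewrite mulnC -[LHS]sum_nat_const; apply: eq_bigr => s _.
  rewrite -sum1dep_card big_mkcondr [RHS](reindex (img s^-1%g)) /=.
    apply: eq_big => [C|C _]; first by rewrite cimg.
    by have := imgK s^-1%g C; rewrite invgK => ->; case: (bad C).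
  exists (img s) => C _; last exact: imgK.
  by have := imgK s^-1%g C; rewrite invgK.
rewrite exchange_big /=.
rewrite -card_draws mulnC cardsE -sum_nat_const; apply: eq_bigr => C /eqP cC.
rewrite -sum1dep_card [RHS]big_mkcond /=.
(* For a fixed set C, a permutation t from A to C transports the count for C
   to the count for A. *)
have [t tA] := perm_imset_eq_card (esym cC).
rewrite [RHS](reindex_inj (mulgI t)); apply: eq_bigr => s _.
by have := imgM t s A; rewrite /img tA => ->; case: (bad _).
Qed.

Lemma superset_of_card (X : finType) (A : {set X}) (M : nat) :
  (#|A| <= M <= #|X|)%N -> exists2 D : {set X}, A \subset D & #|D| = M.
Proof.
case/andP; elim: M => [|M IH] AM MX.
  by exists A => //; apply/eqP; rewrite -leqn0.
move: AM; rewrite leq_eqVlt => /predU1P[<-|AM]; first by exists A.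
have [D AD DM] := IH AM (ltnW MX).
have [x xD] : exists x, x \notin D.
  apply/existsP; rewrite -negb_forall; apply/negP => /forallP DX.
  move: MX; rewrite -DM ltnNge -cardsT subset_leq_card //.
  by apply/fintype.subsetP => x _; exact: DX.
exists (x |: D)%SET; first exact: (fintype.subset_trans AD (finset.subsetUr _ _)).
by rewrite cardsU1 xD DM.
Qed.

(** Random words are easier to analyse than random sets, because their letters
are independent.  A word with at most [M] letters spans a set contained in
some [M]-set, and enlarging a set can only cure badness.  Averaging over all
permutations of the alphabet makes that [M]-set uniform while keeping the word
uniform, so a uniform [M]-set is bad with at most the probability that a
uniform word is. *)
Lemma bad_subsets_le_bad_words (X Wd : finType) (bad : {set X} -> bool)
    (letters : Wd -> {set X}) (act : {perm X} -> Wd -> Wd) (M : nat) :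
  (forall A B : {set X}, A \subset B -> bad B -> bad A) ->
  (forall s, injective (act s)) ->
  (forall s w, letters (act s w) = [set s x | x in letters w]%SET) ->
  (forall w, #|letters w| <= M)%N -> (M <= #|X|)%N ->
  (#|[set C : {set X} | (#|C| == M) && bad C]%SET| * #|Wd| <=
   #|[set w | bad (letters w)]%SET| * 'C(#|X|, M))%N.
Proof.
move=> mono actI lact lM MX.
have P0 : (0 < #|{perm X}|)%N by apply/card_gt0P; exists 1%g.
rewrite -(leq_pmul2r P0) -mulnA (mulnC #|Wd|) mulnA.
have -> : (#|[set w | bad (letters w)]%SET| * 'C(#|X|, M) * #|{perm X}| =
    \sum_w #|[set s : {perm X} | bad [set s x | x in letters w]]%SET| *
      'C(#|X|, M))%N.
  rewrite -big_distrl /= mulnAC; congr (_ * _)%N.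
  under [RHS]eq_bigr do rewrite -sum1dep_card big_mkcond.
  rewrite exchange_big /= mulnC -sum_nat_const; apply: eq_bigr => s _.
  rewrite -sum1dep_card big_mkcond (reindex_inj (actI s)) /=.
  by apply: eq_bigr => w _; rewrite lact.
rewrite mulnC -[leqLHS]sum_nat_const; apply: leq_sum => w _.
have [|D wD cD] := @superset_of_card X (letters w) M; first by rewrite lM MX.
rewrite -{1}cD permuted_bad_count cD leq_mul2r; apply/orP; right.
apply: subset_leq_card; apply/fintype.subsetP => s; rewrite !inE.
exact/mono/imsetS.
Qed.

(** * Typical pairs of rows *)

Lemma ln_le_subr1 (R : realType) (x : R) : 0 < x -> ln x <= x - 1.
Proof.
by move=> x0; rewrite lerBrDl -[leRHS](lnK (x := x)) ?posrE // expR_ge1Dx.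
Qed.

Lemma big_pairs (R : realType) (A B : finType) (F : A * B -> R) :
  \sum_s F s = \sum_a \sum_b F (a, b).
Proof. by rewrite pair_big /=; apply: eq_bigr => -[a b]. Qed.

Definition marginal (R : realType) (A : finType) (p : A * A -> R) (a : A) : R :=
  \sum_b p (a, b).

Lemma sum_marginal (R : realType) (A : finType) (p : A * A -> R) (g : A -> R) :
  \sum_s p s * g s.1 = \sum_a marginal p a * g a.
Proof.
rewrite big_pairs /=.
by apply: eq_bigr => a _; rewrite mulr_suml.
Qed.

Lemma marginal_gt0 (R : realType) (A : finType) (p : A * A -> R) (a : A) :
  (forall s, 0 < p s) -> 0 < marginal p a.
Proof.
move=> p0; rewrite /marginal (bigD1 a) //=.
by apply: ltr_wpDr => //; apply: sumr_ge0 => b _; exact: ltW.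
Qed.

(** Subadditivity of entropy for a law with equal marginals: the joint entropy
is at most twice the marginal entropy.  It follows from [ln x <= x - 1] at the
ratio of the product of the marginals to the joint law. *)
Lemma joint_entropy_le (R : realType) (A : finType) (p : A * A -> R) :
  (forall s, 0 < p s) -> \sum_s p s = 1 ->
  (forall a b, p (a, b) = p (b, a)) ->
  2 * (\sum_s p s * ln (marginal p s.1)) <= \sum_s p s * ln (p s).
Proof.
move=> p0 p1 psym; set m := marginal p.
have m0 a : 0 < m a by exact: marginal_gt0.
have swap (g : A -> R) : \sum_s p s * g s.2 = \sum_s p s * g s.1.
  rewrite big_pairs /= exchange_big.
  rewrite [RHS]big_pairs /=.
  by apply: eq_bigr => a _; apply: eq_bigr => b _; rewrite psym.
have m1 : \sum_a m a = 1.
  rewrite -[RHS]p1; under eq_bigr do rewrite -[m _]mulr1.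
  by rewrite -(sum_marginal p (fun=> 1)); apply: eq_bigr => s _; rewrite mulr1.
rewrite (_ : 2 * _ = \sum_s p s * ln (m s.1) + \sum_s p s * ln (m s.2)); last first.
  by rewrite (swap (fun a => ln (m a))); ring.
rewrite -subr_le0 -big_split -sumrB /=.
apply: (@le_trans _ _ (\sum_s (m s.1 * m s.2 - p s))).
  apply: ler_sum => s _.
  have -> : p s * ln (m s.1) + p s * ln (m s.2) - p s * ln (p s) =
     p s * ln (m s.1 * m s.2 / p s).
    by rewrite lnM ?posrE ?invr_gt0 ?mulr_gt0 // lnM ?posrE // lnV ?posrE //; ring.
  have -> : m s.1 * m s.2 - p s = p s * (m s.1 * m s.2 / p s - 1).
    by field; rewrite gt_eqF.
  by rewrite ler_pM2l // ln_le_subr1 // divr_gt0 // mulr_gt0.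
rewrite sumrB p1 big_pairs /=.
under eq_bigr do rewrite -mulr_sumr m1 mulr1.
by rewrite m1 subrr.
Qed.

Lemma sum_rows (R : realType) (A : finType) (n : nat) (F : 'rV[A]_n -> R) :
  \sum_x F x = \sum_(f : {ffun 'I_n -> A}) F (\row_j f j).
Proof.
apply: reindex; exists (fun x : 'rV[A]_n => [ffun j => x 0 j]).
  by move=> f _; apply/ffunP => j; rewrite ffunE mxE.
by move=> x _; apply/rowP => j; rewrite mxE ffunE.
Qed.

Lemma sum_row_pairs (R : realType) (A : finType) (n : nat)
    (F : 'rV[A]_n -> 'rV[A]_n -> R) :
  \sum_x \sum_y F x y =
  \sum_(z : {ffun 'I_n -> A * A}) F (\row_j (z j).1) (\row_j (z j).2).
Proof.
rewrite pair_big /=.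
apply: (@reindex _ _ _ _ _
  (fun z : {ffun 'I_n -> A * A} => (\row_j (z j).1, \row_j (z j).2))).
exists (fun xy : 'rV[A]_n * 'rV[A]_n => [ffun j => (xy.1 0 j, xy.2 0 j)]).
  by move=> z _; apply/ffunP => j; rewrite ffunE !mxE; case: (z j).
by case=> x y _; congr pair; apply/rowP => j; rewrite mxE ffunE.
Qed.

Lemma sum_row_prod (R : realType) (A : finType) (n : nat) (g : 'I_n -> A -> R) :
  \sum_(x : 'rV[A]_n) \prod_j g j (x 0 j) = \prod_j \sum_a g j a.
Proof.
rewrite sum_rows bigA_distr_bigA; apply: eq_bigr => f _.
by apply: eq_bigr => j _; rewrite mxE.
Qed.

Lemma prod_le_expR (R : realType) (I : finType) (u : I -> R) (c : R) :
  (forall i, 0 < u i) -> \sum_i ln (u i) <= c -> \prod_i u i <= expR c.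
Proof.
move=> u0 uc; rewrite (eq_bigr (fun i => expR (ln (u i)))) -?expR_sum ?ler_expR //.
by move=> i _; rewrite lnK // posrE.
Qed.

(** The weight is the [n]-fold product of [p], cut down to the pairs for which
four sums over the columns exceed their means by at most a small multiple of
[n]: those of the cost [f], of the log-probability of the pair, and of the
log-probabilities of its two components.  Each of these
events has probability tending to 1, so at least half of the mass remains.
The cut bounds the weights by the typical probability of a pair, and the
marginal sums by the typical probability of a single row; by
[joint_entropy_le] the latter is at most about the square root of the former,
which is why one [b] serves for both. *)
Lemma typical_weight (R : realType) (A : finType) (p : A * A -> R)
    (f : A * A -> R) (rho d : R) :
  (forall s, 0 < p s) -> \sum_s p s = 1 ->
  (forall a b, p (a, b) = p (b, a)) ->
  \sum_s p s * f s < rho -> 0 < d ->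
  exists n0 : nat, forall n, (n0 <= n)%N ->
  exists W : 'rV[A]_n -> 'rV[A]_n -> R,
  let b := expR (n%:R * (2^-1 * (\sum_s p s * ln (p s)) + d)) in
  [/\ forall x y, 0 <= W x y <= b ^+ 2,
      forall x, \sum_y W x y <= b,
      forall y, \sum_x W x y <= b,
      2^-1 <= \sum_x \sum_y W x y &
      forall x y, W x y != 0 -> \sum_j f (x 0 j, y 0 j) <= rho * n%:R].
Proof.
move=> p0 p1 psym frho d0.
have p0' s : 0 <= p s by exact: ltW.
pose m := marginal p.
have m0 a : 0 < m a by exact: marginal_gt0.
pose e1 := \sum_s p s * f s.
pose e2 := \sum_s p s * ln (p s).
pose e3 := \sum_s p s * ln (m s.1).
have e3le : 2 * e3 <= e2 by exact: joint_entropy_le.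
have e4e : \sum_s p s * ln (m s.2) = e3.
  rewrite big_pairs /= exchange_big.
  rewrite /e3 big_pairs /=.
  by apply: eq_bigr => a _; apply: eq_bigr => b _; rewrite psym.
(* v g e c / n is the Chebyshev bound for the sum of the g-values to exceed
   n (e + c), and V adds the four bounds. *)
pose v (g : A * A -> R) (e c : R) := (\sum_s p s * (g s - e) ^+ 2) / c ^+ 2.
pose V := v f e1 (rho - e1) + v (fun s => ln (p s)) e2 d +
  v (fun s => ln (m s.1)) e3 d + v (fun s => ln (m s.2)) e3 d.
exists (Num.truncn (2 * V)).+1 => n nV.
have n0 : (0 < n)%N by exact: leq_trans nV.
have nR : 0 < n%:R :> R by rewrite ltr0n.
have Vn : V / n%:R <= 2^-1.
  rewrite ler_pdivrMr // mulrC ler_pdivlMr ?ltr0n // mulrC.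
  by apply/ltW/(lt_le_trans (truncnS_gt _)); rewrite ler_nat.
pose exceeds (g : A * A -> R) (c : R) (x y : 'rV[A]_n) : bool :=
  n%:R * c < \sum_j g (x 0 j, y 0 j).
pose T (x y : 'rV[A]_n) := [&& ~~ exceeds f (e1 + (rho - e1)) x y,
  ~~ exceeds (fun s => ln (p s)) (e2 + d) x y,
  ~~ exceeds (fun s => ln (m s.1)) (e3 + d) x y &
  ~~ exceeds (fun s => ln (m s.2)) (e3 + d) x y].
pose W (x y : 'rV[A]_n) := (\prod_j p (x 0 j, y 0 j)) * (T x y)%:R.
set b := expR _.
exists W => /=.
have pr0 x y : 0 <= \prod_(j < n) p (x 0 j, y 0 j) by apply: prodr_ge0.
have W0 x y : 0 <= W x y by rewrite mulr_ge0.
have Wle x y : W x y <= \prod_j p (x 0 j, y 0 j).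
  by rewrite /W; case: (T x y); rewrite ?mulr1 ?mulr0.
have ble (u : 'I_n -> R) : (forall j, 0 < u j) ->
    \sum_j ln (u j) <= n%:R * (e3 + d) -> \prod_j u j <= b.
  move=> u0 ule; apply: prod_le_expR => //; apply: (le_trans ule).
  by rewrite ler_pM2l // lerD2r -/e2; lra.
split.
- move=> x y; rewrite W0 /=.
  have [Txy|/negbTE Txy] := boolP (T x y); last by rewrite /W Txy mulr0 sqr_ge0.
  apply: (le_trans (Wle x y)); rewrite /b -expRM_natl.
  apply: prod_le_expR => //; case/and4P: Txy => _; rewrite /exceeds -leNgt /= => h _ _.
  apply: (le_trans h); rewrite mulrCA ler_pM2l // -/e2; lra.
- move=> x.
  have [/ble mx|mx] := leP (\sum_j ln (m (x 0 j))) (n%:R * (e3 + d)).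
    apply: le_trans (mx _) => //; rewrite -sum_row_prod.
    by apply: ler_sum => y _; exact: Wle.
  rewrite big1 ?expR_ge0 // => y _; rewrite /W /T.
  by rewrite {3}/exceeds /= mx /= !andbF mulr0.
- move=> y.
  have [/ble my|my] := leP (\sum_j ln (m (y 0 j))) (n%:R * (e3 + d)).
    apply: le_trans (my _) => //; rewrite -sum_row_prod.
    by apply: ler_sum => x _; apply: (le_trans (Wle x y)); under eq_bigr do rewrite psym.
  rewrite big1 ?expR_ge0 // => x _; rewrite /W /T.
  by rewrite {4}/exceeds /= my /= !andbF mulr0.
- rewrite sum_row_pairs.
  pose bad (g : A * A -> R) c (z : {ffun 'I_n -> A * A}) : R :=
    (#|'I_n|%:R * c < \sum_j g (z j))%R%:R.
  have tail (g : A * A -> R) e c : \sum_s p s * g s = e -> 0 < c ->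
      iidE p (bad g (e + c)) <= v g e c / n%:R.
    by move=> ge c0; rewrite -[n in n%:R]card_ord; apply: iid_upper_tail; rewrite ?card_ord.
  have E1 : 1 - V / n%:R <=
      iidE p (fun z => 1 + (-1) * (bad f (e1 + (rho - e1)) z +
        bad (fun s => ln (p s)) (e2 + d) z + bad (fun s => ln (m s.1)) (e3 + d) z +
        bad (fun s => ln (m s.2)) (e3 + d) z)).
    rewrite iidED iidE_cst // iidEZ !iidED mulN1r lerD2l lerN2 /V !mulrDl.
    by repeat apply: lerD; apply: tail => //; rewrite subr_gt0.
  apply: le_trans (le_trans E1 _); first by lra.
  apply: ler_sum => z _; rewrite /W.
  under [X in _ <= X * _]eq_bigr => j _ do rewrite !mxE -surjective_pairing.
  apply: ler_wpM2l; first exact: prodr_ge0.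
  rewrite /T.
  have ex g c : exceeds g c (\row_j (z j).1) (\row_j (z j).2) =
      (#|'I_n|%:R * c < \sum_j g (z j)).
    rewrite /exceeds card_ord; congr (_ < _); apply: eq_bigr => j _.
    by rewrite !mxE -surjective_pairing.
  rewrite !ex /bad.
  do 4 case: (_ < _) => /=; lra.
- move=> x y; rewrite /W mulf_eq0 negb_or => /andP[_].
  case: (boolP (T x y)) => [/and4P[+ _ _ _] _|]; last by rewrite eqxx.
  by rewrite /exceeds -leNgt addrC subrK mulrC.
Qed.

(** * Covering by random codes *)

Definition covers (R : realType) (G : finZmodType) (n : nat) (rho : R)
    (C : {set 'rV[G]_n}) : bool :=
  [forall u : 'M[G]_(2, n),
    [exists c in code2 C, (d2 c u)%:R <= rho * n%:R :> R]].

Lemma covers_R2 (R : realType) (G : finZmodType) (n : nat) (rho : R)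
    (C : {set 'rV[G]_n}) :
  covers rho C -> (R2 R C <= (rho * n%:R)%:E)%E.
Proof.
move=> /forallP cov; apply: bigmax_le => [|u _]; first exact: leNye.
have /existsP[c /andP[cC cu]] := cov u.
by apply/bigmin_leP; right; exists c => //; rewrite lee_fin.
Qed.

Lemma covers_mono (R : realType) (G : finZmodType) (n : nat) (rho : R)
    (A B : {set 'rV[G]_n}) :
  A \subset B -> ~~ covers rho B -> ~~ covers rho A.
Proof.
move=> /fintype.subsetP AB; apply: contraNN => /forallP cov.
apply/forallP => u; have /existsP[c /andP[+ cu]] := cov u.
rewrite inE => /forallP cA; apply/existsP; exists c; rewrite inE cu andbT.
by apply/forallP => i; exact/AB/cA.
Qed.

Lemma row0_col_mx (T : Type) (n : nat) (x y : 'rV[T]_n) :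
  row 0 (col_mx x y : 'M[T]_(2, n)) = x.
Proof.
apply/rowP => j; rewrite mxE -[RHS](col_mxEu x y).
by congr (fun_of_matrix _ _ j); apply/val_inj.
Qed.

Lemma row1_col_mx (T : Type) (n : nat) (x y : 'rV[T]_n) :
  row 1 (col_mx x y : 'M[T]_(2, n)) = y.
Proof.
apply/rowP => j; rewrite mxE -[RHS](col_mxEd x y).
by congr (fun_of_matrix _ _ j); apply/val_inj.
Qed.

Lemma d2_count (R : realType) (G : finZmodType) (n : nat) (c u : 'M[G]_(2, n)) :
  (d2 c u)%:R = \sum_j (((row 0 u - row 0 c) 0 j, (row 1 u - row 1 c) 0 j)
    != (0, 0))%:R :> R.
Proof.
rewrite /d2 /wt2 -sum1dep_card natr_sum big_mkcond /=; apply: eq_bigr => j _.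
rewrite (_ : (col j (u - c) != 0) = (((row 0 u - row 0 c) 0 j,
  (row 1 u - row 1 c) 0 j) != (0, 0))); first by case: (_ != _).
congr (~~ _); rewrite xpair_eqE !mxE; apply/eqP/andP => [/colP e|[/eqP e0 /eqP e1]].
  by have := e 0; have := e 1; rewrite !mxE => -> ->.
apply/colP => i; rewrite !mxE.
have /orP[/eqP -> //|/eqP -> //] : (i == 0) || (i == 1).
by case: i => [[|[|]]].
Qed.

Lemma leq_card_cover (S U : finType) (A : {set S}) (F : U -> {set S}) :
  (forall x, x \in A -> exists u, x \in F u) -> (#|A| <= \sum_u #|F u|)%N.
Proof.
move=> AF; rewrite -sum1_card big_mkcond.
under [leqRHS]eq_bigr do rewrite -sum1_card big_mkcond.
rewrite exchange_big; apply: leq_sum => x _; case: ifP => // /AF[u xu].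
by rewrite (bigD1 u) //= xu.
Qed.

(** A word of [K * m * 2] letters is kept as [K] chunks of [m] first and [m]
second components, since the second-moment bound applies to one chunk and the
chunks are independent. *)
Definition word_letters (X : finType) (K m : nat)
    (w : {ffun 'I_K -> {ffun 'I_m -> X} * {ffun 'I_m -> X}}) : {set X} :=
  [set (if t.2 then (w t.1.1).1 t.1.2 else (w t.1.1).2 t.1.2)
    | t : 'I_K * 'I_m * bool]%SET.

(** The letterwise action used to average over permutations of the alphabet. *)
Definition word_act (X : finType) (K m : nat) (s : {perm X})
    (w : {ffun 'I_K -> {ffun 'I_m -> X} * {ffun 'I_m -> X}}) :
    {ffun 'I_K -> {ffun 'I_m -> X} * {ffun 'I_m -> X}} :=
  [ffun k => ([ffun i => s ((w k).1 i)], [ffun i => s ((w k).2 i)])].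

Lemma word_act_inj (X : finType) (K m : nat) (s : {perm X}) :
  injective (@word_act X K m s).
Proof.
move=> w1 w2 /ffunP e; apply/ffunP => k; have := e k; rewrite !ffunE.
case: (w1 k) (w2 k) => [x1 y1] [x2 y2] /= [/ffunP ex /ffunP ey].
congr pair; apply/ffunP => i.
  by have := ex i; rewrite !ffunE => /perm_inj.
by have := ey i; rewrite !ffunE => /perm_inj.
Qed.

Lemma word_letters_act (X : finType) (K m : nat) (s : {perm X})
    (w : {ffun 'I_K -> {ffun 'I_m -> X} * {ffun 'I_m -> X}}) :
  word_letters (word_act s w) = [set s x | x in word_letters w]%SET.
Proof.
rewrite /word_letters -imset_comp; apply: eq_imset => -[[k i] c] /=.
by rewrite ffunE /=; case: c; rewrite ffunE.
Qed.

Lemma card_word_letters (X : finType) (K m : nat)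
    (w : {ffun 'I_K -> {ffun 'I_m -> X} * {ffun 'I_m -> X}}) :
  (#|word_letters w| <= K * m * 2)%N.
Proof.
apply: (leq_trans (leq_imset_card _ _)).
by rewrite !card_prod !card_ord card_bool.
Qed.

Lemma mem_word_letters (X : finType) (K m : nat)
    (w : {ffun 'I_K -> {ffun 'I_m -> X} * {ffun 'I_m -> X}}) k i :
  ((w k).1 i \in word_letters w) && ((w k).2 i \in word_letters w).
Proof.
by apply/andP; split; apply/imsetP; [exists (k, i, true)|exists (k, i, false)].
Qed.

(** Covering the matrix with rows [u0] and [u1] is covering the origin after a
translation, which permutes the rows and so changes no sum in the
hypotheses. *)
Lemma miss_shift_count (R : realType) (G : finZmodType) (n m : nat)
    (W : 'rV[G]_n -> 'rV[G]_n -> R) (b : R) (u0 u1 : 'rV[G]_n) :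
  (0 < m)%N ->
  (forall x y, 0 <= W x y <= b ^+ 2) ->
  (forall x, \sum_y W x y <= b) -> (forall y, \sum_x W x y <= b) ->
  2^-1 <= \sum_x \sum_y W x y ->
  #|[set w : {ffun 'I_m -> 'rV[G]_n} * {ffun 'I_m -> 'rV[G]_n} |
     [forall i, forall j, W (u0 - w.1 i) (u1 - w.2 j) == 0]]|%:R <=
  6 * ((#|G| ^ n)%:R / m%:R * b) * ((#|G| ^ n)%:R ^+ m) ^+ 2.
Proof.
move=> m0 W0b rowb colb W2.
have XE : #|{: 'rV[G]_n}| = (#|G| ^ n)%N by rewrite card_mx mul1n.
have shift (u : 'rV[G]_n) (F : 'rV[G]_n -> R) : \sum_x F (u - x) = \sum_x F x.
  by rewrite [RHS](reindex_inj (subrI u)).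
rewrite -XE; apply: (@miss_count _ _ _ (fun x y => W (u0 - x) (u1 - y))) => //.
- by apply/card_gt0P; exists 0.
- by move=> x y; case/andP: (W0b (u0 - x) (u1 - y)).
- by move=> x y; case/andP: (W0b (u0 - x) (u1 - y)).
- by move=> x; rewrite (shift u1 (W (u0 - x))).
- by move=> y; rewrite (shift u0 (W^~ (u1 - y))).
- under eq_bigr do rewrite (shift u1 (W (u0 - _))).
  by rewrite (shift u0 (fun x => \sum_y W x y)).
Qed.

(** A bad word leaves some matrix [u] uncovered, and then each of its [K]
independent chunks misses [u].  The union bound over the [(#|G| ^ n) ^ 2]
matrices costs only a factor, while the failure probability of one chunk is
raised to the power [K].  The statement for words passes to codes of size [M]
by [bad_subsets_le_bad_words]. *)
Lemma alpha_ge (R : realType) (G : finZmodType) (n K m M : nat) (rho b : R)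
    (W : 'rV[G]_n -> 'rV[G]_n -> R) :
  (0 < m)%N -> (K * m * 2 <= M)%N -> (M <= #|G| ^ n)%N ->
  (forall x y, 0 <= W x y <= b ^+ 2) ->
  (forall x, \sum_y W x y <= b) -> (forall y, \sum_x W x y <= b) ->
  2^-1 <= \sum_x \sum_y W x y ->
  (forall x y, W x y != 0 ->
     \sum_j ((x 0 j, y 0 j) != (0, 0))%:R <= rho * n%:R) ->
  1 - (#|G| ^ n)%:R ^+ 2 * (6 * ((#|G| ^ n)%:R / m%:R * b)) ^+ K
    <= alpha G n rho M.
Proof.
move=> m0 KM MN W0b rowb colb W2 Wnear.
have XE : #|{: 'rV[G]_n}| = (#|G| ^ n)%N by rewrite card_mx mul1n.
set N := (#|G| ^ n)%N in XE MN *.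
pose X : finType := 'rV[G]_n.
pose Wd : finType := {ffun 'I_K -> {ffun 'I_m -> X} * {ffun 'I_m -> X}}.
pose miss (u : 'M[G]_(2, n)) := [set w : {ffun 'I_m -> X} * {ffun 'I_m -> X} |
     [forall i, forall j, W (row 0 u - w.1 i) (row 1 u - w.2 j) == 0]].
set bnd := 6 * _.
have missb u : #|miss u|%:R <= bnd * (N%:R ^+ m) ^+ 2 by exact: miss_shift_count.
pose bad (C : {set X}) := ~~ covers rho C.
have badw : (#|[set w : Wd | bad (word_letters w)]%SET| <=
    \sum_(u : 'M[G]_(2, n)) #|miss u| ^ K)%N.
  pose F u := [set w : Wd | w \in ffun_on (mem (miss u))].
  apply: (@leq_trans (\sum_u #|F u|)%N); last first.
    by apply: leq_sum => u _; rewrite cardsE card_ffun_on card_ord.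
  apply: leq_card_cover => w; rewrite inE => /forallPn[u /existsPn un].
  exists u; rewrite inE; apply/ffun_onP => k; rewrite inE.
  apply/forallP => i; apply/forallP => j; apply: contraT => Wij.
  (* A pair of letters of nonzero weight would be the two rows of a matrix over
     the code at distance at most rho n from u. *)
  have /andP[xw _] := mem_word_letters w k i.
  have /andP[_ yw] := mem_word_letters w k j.
  have := un (col_mx ((w k).1 i) ((w k).2 j)).
  rewrite d2_count.
  rewrite row0_col_mx row1_col_mx Wnear // andbT inE => /forallPn[l].
  have /orP[/eqP ->|/eqP ->] : (l == 0) || (l == 1) by case: l => [[|[|]]].
    by rewrite row0_col_mx xw.
  by rewrite row1_col_mx yw.
have count := @bad_subsets_le_bad_words X Wd bad (@word_letters X K m)
  (@word_act X K m) M (@covers_mono R G n rho) (@word_act_inj X K m)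
  (@word_letters_act X K m)
  (fun w => leq_trans (card_word_letters w) KM).
rewrite XE in count; move: (count MN); rewrite -(ler_nat R) !natrM => {}count.
set B := #|_| in count.
have C0 : 0 < 'C(N, M)%:R :> R by rewrite ltr0n bin_gt0.
have N0 : (0 < N)%N by rewrite -XE; apply/card_gt0P; exists 0.
have NR : 0 < N%:R :> R by rewrite ltr0n.
have WdE : #|Wd|%:R = ((N%:R ^+ m) ^+ 2) ^+ K :> R.
  by rewrite card_ffun card_prod !card_ffun !card_ord XE mulnn !natrX.
have BC : B%:R <= N%:R ^+ 2 * bnd ^+ K * 'C(N, M)%:R.
  rewrite -(ler_pM2r (x := #|Wd|%:R)); last by rewrite WdE !exprn_gt0.
  apply: (le_trans count); rewrite mulrAC ler_pM2r //.
  apply: (@le_trans _ _ (\sum_(u : 'M[G]_(2, n)) #|miss u| ^ K)%N%:R).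
    by rewrite ler_nat.
  rewrite natr_sum.
  apply: (@le_trans _ _ (\sum_(u : 'M[G]_(2, n)) (bnd ^+ K * #|Wd|%:R))).
    apply: ler_sum => u _; rewrite WdE -exprMn natrX.
    by rewrite lerXn2r ?nnegrE //; apply: le_trans (missb u).
  by rewrite sumr_const card_mx mulnC expnM -[leLHS]mulr_natl natrX mulrA.
have tot : 'C(N, M)%:R <= B%:R + #|[set C : {set 'rV[G]_n} |
      (#|C| == M) && (R2 R C <= (rho * n%:R)%:E)%E]|%:R :> R.
  rewrite -natrD ler_nat -XE -card_draws.
  apply: leq_trans (leq_card_setU _ _); apply: subset_leq_card.
  apply/fintype.subsetP => C; rewrite !inE => -> /=.
  by case: (boolP (covers rho C)) => [/covers_R2 -> | nC]; rewrite ?orbT // /bad nC.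
rewrite /alpha -/N ler_pdivlMr // mulrBl mul1r; lra.
Qed.

Local Open Scope classical_set_scope.

(** * The entropy function *)

(** The law of one column: zero with probability [1 - r], and otherwise uniform
among the nonzero columns.  Its entropy is [entropy (#|G| ^ 2) r], in suitable
units, by [column_law_entropy]. *)
Definition column_law (R : realType) (G : finZmodType) (r : R) (s : G * G) : R :=
  if s == (0, 0) then 1 - r else r / ((#|G| ^ 2)%:R - 1).

Lemma sum_zero_or_not (R : realType) (G : finZmodType) (a c : R) :
  \sum_(s : G * G) (if s == (0, 0) then a else c) = a + ((#|G| ^ 2)%:R - 1) * c.
Proof.
rewrite (bigD1 (0, 0)) //= eqxx; congr (_ + _).
under eq_bigr => s /negbTE -> do [].
rewrite sumr_const cardC1 card_prod mulnn -[LHS]mulr_natl -subn1 natrB //.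
by rewrite expn_gt0; apply/orP; left; apply/card_gt0P; exists 0.
Qed.

Lemma card_sqr_gt1 (R : realType) (q : nat) :
  (2 <= q)%N -> 1 < (q ^ 2)%N%:R :> R.
Proof. by move=> q2; rewrite ltr1n -(exp1n 2) ltn_exp2r. Qed.

Lemma column_law_gt0 (R : realType) (G : finZmodType) (r : R) (s : G * G) :
  (2 <= #|G|)%N -> 0 < r < 1 -> 0 < column_law r s.
Proof.
move=> /(card_sqr_gt1 R) q1 /andP[r0 r1]; rewrite /column_law; case: ifP => _.
  lra.
by rewrite divr_gt0 // subr_gt0.
Qed.

Lemma sum_column_law (R : realType) (G : finZmodType) (r : R) (F : G * G -> R)
    (a c : R) :
  (2 <= #|G|)%N -> (forall s, F s = if s == (0, 0) then a else c) ->
  \sum_s column_law r s * F s = (1 - r) * a + r * c.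
Proof.
move=> /(card_sqr_gt1 R) q1 FE.
rewrite (eq_bigr (fun s => if s == (0, 0) then (1 - r) * a else
   r / ((#|G| ^ 2)%:R - 1) * c)).
  by rewrite sum_zero_or_not; field; lra.
by move=> s _; rewrite FE /column_law; case: ifP.
Qed.

Lemma column_law_entropy (R : realType) (G : finZmodType) (r : R) :
  (2 <= #|G|)%N -> 0 < r < 1 ->
  \sum_(s : G * G) column_law r s * ln (column_law r s) =
  - (2 * ln #|G|%:R) * entropy (#|G| ^ 2)%N r.
Proof.
move=> q2 r01; have q1 := card_sqr_gt1 R q2; case/andP: r01 => r0 r1.
have L0 : 0 < ln (#|G|%:R : R) by rewrite ln_gt0 // ltr1n.
rewrite (@sum_column_law _ _ _ _ (ln (1 - r)) (ln (r / ((#|G| ^ 2)%:R - 1)))) //.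
  rewrite ln_div ?posrE ?subr_gt0 // /entropy /logb.
  have -> : ln ((#|G| ^ 2)%N%:R : R) = 2 * ln #|G|%:R.
    by rewrite natrX lnXn ?ltr0n 1?ltnW // mulr_natl.
  by field; rewrite gt_eqF.
by move=> s; rewrite /column_law; case: ifP.
Qed.

(** Gibbs' inequality against the uniform law, that is [ln x <= x - 1] used
once for the zero symbol and once for the others. *)
Lemma entropy_le1 (R : realType) (Q : nat) (x : R) :
  (2 <= Q)%N -> 0 < x < 1 -> entropy Q x <= 1.
Proof.
move=> Q2 /andP[x0 x1]; have Q1 : 1 < Q%:R :> R by rewrite ltr1n.
have L0 : 0 < ln (Q%:R : R) by rewrite ln_gt0.
rewrite /entropy /logb -(ler_pM2r L0) mul1r.
rewrite (_ : _ * ln _ = x * ln (Q%:R - 1) - x * ln x - (1 - x) * ln (1 - x)); last first.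
  by field; rewrite gt_eqF.
have x1' : 0 < 1 - x by lra.
have Q0 : 0 < Q%:R :> R by lra.
have Q1' : 0 < Q%:R - 1 :> R by lra.
have h1 : x * (ln (Q%:R - 1) - ln x - ln Q%:R) <= (Q%:R - 1) / Q%:R - x.
  have -> : (Q%:R - 1) / Q%:R - x = x * ((Q%:R - 1) / x / Q%:R - 1).
    by field; rewrite !gt_eqF.
  rewrite ler_pM2l // -ln_div ?posrE // -ln_div ?posrE ?divr_gt0 //.
  by apply: ln_le_subr1; rewrite !divr_gt0.
have h2 : (1 - x) * (- ln (1 - x) - ln Q%:R) <= 1 / Q%:R - (1 - x).
  have -> : 1 / Q%:R - (1 - x) = (1 - x) * ((1 - x)^-1 / Q%:R - 1).
    by field; rewrite !gt_eqF.
  rewrite ler_pM2l // -lnV ?posrE // -ln_div ?posrE ?invr_gt0 //.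
  by apply: ln_le_subr1; rewrite !divr_gt0 ?invr_gt0.
have h3 : (Q%:R - 1) / Q%:R + 1 / Q%:R = 1 :> R by field; rewrite gt_eqF.
lra.
Qed.

Lemma entropy_continuous (R : realType) (Q : nat) (x : R) :
  0 < x < 1 -> {for x, continuous (@entropy R Q)}.
Proof.
move=> /andP[x0 x1]; rewrite /entropy /logb.
have lnc : {for x, continuous (@ln R)} by exact: continuous_ln.
have lnc' : {for x, continuous (fun y : R => ln (1 - y))}.
  apply: (@continuous_comp _ _ _ (fun y : R => 1 - y) (@ln R)).
    by apply: cvgB; [exact: cvg_cst | exact: cvg_id].
  by apply: continuous_ln; lra.
apply: cvgB; first apply: cvgB.
- by apply: cvgM; [exact: cvg_id | exact: cvg_cst].
- by apply: cvgM; [exact: cvg_id | apply: cvgM; [exact: lnc | exact: cvg_cst]].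
- apply: cvgM; last by apply: cvgM; [exact: lnc' | exact: cvg_cst].
  by apply: cvgB; [exact: cvg_cst | exact: cvg_id].
Qed.

Lemma entropy_below (R : realType) (Q : nat) (x e : R) :
  0 < x < 1 -> 0 < e -> exists2 r, 0 < r < x & entropy Q x - e < entropy Q r.
Proof.
move=> x01 e0; have /andP[x0 x1] := x01.
have /cvgrPdist_lt /(_ e e0) near_x := entropy_continuous (Q := Q) x01.
have near_left : \forall r \near x^'-, `|entropy Q x - entropy Q r| < e.
  exact: cvg_within near_x.
have : \forall r \near x^'-, (0 < r < x) /\ entropy Q x - e < entropy Q r.
  near=> r; split.
    by apply/andP; split; near: r; [exact: nbhs_left_gt | exact: nbhs_left_lt].
  have : `|entropy Q x - entropy Q r| < e by near: r.
  by rewrite ltr_norml => /andP[_]; lra.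
by move=> /filter_ex[r [r0 rx]]; exists r.
Unshelve. all: by end_near.
Qed.

(** * Asymptotics of the code size *)

Lemma natX_expR (R : realType) (q n : nat) :
  (0 < q)%N -> (q ^ n)%N%:R = expR (n%:R * ln q%:R) :> R.
Proof. by move=> q0; rewrite expRM_natl lnK ?posrE ?ltr0n // natrX. Qed.

Lemma codesize_le (R : realType) (q n : nat) (rho eps : R) :
  (0 < q)%N -> (0 < n)%N -> 1 <= n%:R * (entropy (q ^ 2)%N rho - eps) ->
  (codesize q n rho eps <= q ^ n)%N.
Proof.
move=> q0 n0 nge; have nR : 0 < n%:R :> R by rewrite ltr0n.
rewrite /codesize -(@natrK R (q ^ n)%N); apply: le_truncn.
rewrite natrX -powR_mulrn //; apply: ler_powR; first by rewrite ler1n.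
by rewrite !mulrDr mulfV ?gt_eqF //; lra.
Qed.

(** The summand [1 / n] of the exponent multiplies the size by [q >= 2], which
absorbs the rounding. *)
Lemma codesize_ge (R : realType) (q n : nat) (rho eps : R) :
  (2 <= q)%N -> (0 < n)%N -> 0 <= 1 - entropy (q ^ 2)%N rho + eps ->
  expR (n%:R * (ln q%:R * (1 - entropy (q ^ 2)%N rho + eps))) <=
  (codesize q n rho eps)%:R.
Proof.
move=> q2 n0; set H := 1 - _ + _ => H0.
have nR : 0 < n%:R :> R by rewrite ltr0n.
have qR : 2 <= q%:R :> R by rewrite (ler_nat _ 2).
have q0 : 0 < q%:R :> R by lra.
set v := expR _.
have v1 : 1 <= v.
  have L0 : 0 <= ln (q%:R : R) by apply: ln_ge0; lra.
  by rewrite /v -[leLHS]expR0 ler_expR !mulr_ge0.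
rewrite /codesize -/H.
have -> : (q%:R : R) `^ (n%:R * (H + n%:R^-1)) = v * q%:R.
  rewrite mulrDr mulfV ?gt_eqF // powRD ?powRr1 ?ltW //; last first.
    by apply/implyP => _; rewrite gt_eqF.
  by rewrite /powR gt_eqF // /v; congr (expR _ * _); ring.
have := truncnS_gt (v * q%:R); rewrite -natr1.
have : v * 2 <= v * q%:R by rewrite ler_pM2l //; lra.
lra.
Qed.

Lemma chunk_size_ge (R : realType) (K M : nat) (v : R) :
  (0 < K)%N -> v <= M%:R -> 4 * K%:R <= v ->
  v / (4 * K%:R) <= (M %/ (K * 2))%N%:R.
Proof.
move=> K0 vM Kv; have KR : 0 < K%:R :> R by rewrite ltr0n.
have K2 : (0 < K * 2)%N by rewrite muln_gt0 K0.
have := ltn_ceil M K2; set m := (M %/ _)%N.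
rewrite -(ltr_nat R) !natrM -natr1 => Mm.
rewrite ler_pdivrMr ?mulr_gt0 //.
have : v < (m%:R + 1) * (K%:R * 2) by exact: le_lt_trans Mm.
have -> : (m%:R + 1) * (K%:R * 2) = m%:R * (K%:R * 2) + 2 * K%:R :> R by ring.
lra.
Qed.

Lemma ge_nat_near (R : realType) (c a : R) :
  0 < a -> \forall n \near \oo, c <= n%:R * a.
Proof.
move=> a0; near=> n; rewrite -ler_pdivrMr //.
by near: n; exact: nbhs_infty_ger.
Unshelve. all: by end_near.
Qed.

Lemma alpha_le1 (R : realType) (G : finZmodType) (n M : nat) (rho : R) :
  alpha G n rho M <= 1.
Proof.
rewrite /alpha; set A := #|_|.
have AC : (A <= 'C(#|G| ^ n, M))%N.
  have -> : (#|G| ^ n)%N = #|{: 'rV[G]_n}| by rewrite card_mx mul1n.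
  rewrite -card_draws; apply: subset_leq_card.
  by apply/fintype.subsetP => C; rewrite !inE => /andP[].
(* If M exceeds the number of words, the denominator is 0 and so is alpha. *)
have [->|C0] := eqVneq 'C(#|G| ^ n, M) 0%N; first by rewrite invr0 mulr0.
by rewrite ler_pdivrMr ?mul1r ?ler_nat // ltr0n lt0n.
Qed.

(** Write [H] for the entropy at [rho] and [L] for [ln #|G|].  Take [r < rho]
whose entropy exceeds [H - eps / 4], so that typical pairs for [column_law r]
have at most [rho * n] nonzero columns and [b] is at most
[expR (n L (- H + eps / 2))].  With [m] of order [expR (n L (1 - H + eps))],
one chunk misses a matrix with probability at most a constant times
[expR (- n L eps / 2)].  The number [K] of chunks is chosen with
[6 <= K * eps], so that the power [K] is at most a constant times
[expR (- 3 n L)]; after the union bound over [expR (2 n L)] matrices a factor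
[expR (- n L)] remains. *)
Lemma alpha_ge_geometric (R : realType) (G : finZmodType) (rho eps : R) :
  (2 <= #|G|)%N -> 0 < rho < 1 -> 0 < eps ->
  eps < entropy (#|G| ^ 2)%N rho ->
  exists c : R, \forall n \near \oo,
    1 - geometric c #|G|%:R^-1 n <=
    alpha G n rho (codesize #|G| n rho eps).
Proof.
set q := #|G|; set H := entropy _ rho => q2 rho01 e0 eH.
have q0 : (0 < q)%N by exact: ltnW.
have qR : 0 < q%:R :> R by rewrite ltr0n.
set L := ln (q%:R : R); have L0 : 0 < L by rewrite ln_gt0 // ltr1n.
have H1 : H <= 1 by apply: entropy_le1 => //; rewrite -(ltr1n R) card_sqr_gt1.
have [r /andP[r0 r_rho] Hr] : exists2 r, 0 < r < rho & H - eps / 4 < entropy (q ^ 2)%N r.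
  by apply: entropy_below => //; rewrite divr_gt0.
have r01 : 0 < r < 1 by lra.
pose p : G * G -> R := column_law r.
have p0 s : 0 < p s by exact: column_law_gt0.
have p1 : \sum_s p s = 1.
  under eq_bigr do rewrite -[p _]mulr1.
  rewrite (@sum_column_law _ _ _ _ 1 1) //; first by ring.
  by move=> s; case: ifP.
have psym a b : p (a, b) = p (b, a) by rewrite /p /column_law !xpair_eqE andbC.
have pf : \sum_s p s * (s != (0, 0))%:R < rho.
  rewrite (@sum_column_law _ _ _ _ 0 1) //; first by lra.
  by move=> s; case: eqP.
have pln : 2^-1 * \sum_s p s * ln (p s) <= L * (- H + eps / 4).
  rewrite column_law_entropy // -/q -/L; set h := entropy _ r in Hr *.
  have -> : 2^-1 * (- (2 * L) * h) = L * (- h) by field.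
  by rewrite ler_pM2l //; lra.
have d0 : 0 < L * (eps / 4) by rewrite mulr_gt0 // divr_gt0.
have [n0 typical] := typical_weight p0 p1 psym pf d0.
have [K K_gt0 K6] : exists2 K : nat, (0 < K)%N & 6 <= K%:R * eps.
  exists (Num.truncn (6 / eps)).+1 => //.
  by rewrite -ler_pdivrMr //; apply/ltW/truncnS_gt.
have KR : 0 < K%:R :> R by rewrite ltr0n.
exists ((24 * K%:R) ^+ K); near=> n.
have n_gt0 : (0 < n)%N by near: n; exists 1%N.
have nR : 0 < n%:R :> R by rewrite ltr0n.
have nn0 : (n0 <= n)%N by near: n; exists n0.
have nH : 1 <= n%:R * (H - eps) by near: n; apply: ge_nat_near; rewrite subr_gt0.
have nK : 4 * K%:R <= n%:R * (L * eps).
  by near: n; apply: ge_nat_near; rewrite mulr_gt0.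
have [W] := typical n nn0; set b := expR _ => -[W0b rowb colb W2 Wnear].
have MN := codesize_le q0 n_gt0 nH.
have Mv : _ <= (codesize q n rho eps)%:R := @codesize_ge _ q n rho eps q2 n_gt0 _.
rewrite -/H in Mv; have {}Mv := Mv ltac:(lra).
set M := codesize _ _ _ _ in MN Mv *; set v := expR _ in Mv.
have vK : 4 * K%:R <= v.
  apply: (le_trans nK); rewrite /v; set y := (X in expR X).
  apply: (@le_trans _ _ y); last by have := expR_ge1Dx y; lra.
  by rewrite ler_pM2l // ler_pM2l //; lra.
have mv := chunk_size_ge K_gt0 Mv vK.
set m := (M %/ (K * 2))%N in mv.
have v0 : 0 < v by exact: expR_gt0.
have mR : 0 < m%:R :> R by apply: lt_le_trans mv; rewrite divr_gt0 // mulr_gt0.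
have KM : (K * m * 2 <= M)%N.
  by rewrite mulnAC mulnC; exact: leq_trunc_div.
apply: le_trans (@alpha_ge _ _ _ K m _ _ _ W _ KM MN W0b rowb colb W2 Wnear);
  last by rewrite -(ltr0n R).
rewrite lerD2l lerN2 -/q.
have bnd : 6 * ((q ^ n)%N%:R / m%:R * b) <=
    24 * K%:R * expR (n%:R * (L * (- (eps / 2)))).
  have mi : m%:R^-1 <= 4 * K%:R / v.
    by rewrite -[leRHS]invrK lef_pV2 ?posrE ?invr_gt0 ?divr_gt0 ?mulr_gt0 // invf_div.
  have bb : b <= expR (n%:R * (L * (- H + eps / 2))).
    rewrite ler_expR ler_pM2l //; lra.
  apply: (@le_trans _ _ (6 * ((q ^ n)%N%:R * (4 * K%:R / v) *
      expR (n%:R * (L * (- H + eps / 2)))))).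
    rewrite ler_pM2l //; apply: ler_pM; rewrite ?divr_ge0 ?expR_ge0 //.
    by rewrite ler_wpM2l.
  rewrite natX_expR // /v -/L -expRN.
  set x1 := n%:R * L; set x2 := - (n%:R * _); set x3 := n%:R * (L * (- H + _)).
  rewrite [leLHS](_ : _ = 24 * K%:R * expR (x1 + x2 + x3)); last first.
    by rewrite !expRD; ring.
  by rewrite ler_pM2l ?mulr_gt0 // ler_expR /x1 /x2 /x3; lra.
have bnd0 : 0 <= 6 * ((q ^ n)%N%:R / m%:R * b).
  by apply: mulr_ge0 => //; apply: mulr_ge0; rewrite ?divr_ge0 ?expR_ge0.
apply: (@le_trans _ _ ((q ^ n)%:R ^+ 2 *
    (24 * K%:R * expR (n%:R * (L * (- (eps / 2))))) ^+ K)).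
  by rewrite ler_wpM2l ?sqr_ge0 // lerXn2r ?nnegrE // (le_trans bnd0).
rewrite exprMn mulrCA ler_pM2l; last by rewrite exprn_gt0 // mulr_gt0.
rewrite natX_expR // -/L -!expRM_natl -expRD.
have -> : q%:R^-1 ^+ n = expR (n%:R * - L) :> R.
  by rewrite expRM_natl expRN lnK ?posrE.
rewrite ler_expR.
rewrite (_ : _ + _ = n%:R * (L * (2 - K%:R * eps / 2))); last by field.
by rewrite ler_pM2l // -[- L]mulrN1 ler_pM2l //; lra.
Unshelve. all: by end_near.
Qed.

Theorem theorem3 (R : realType) (q : nat) (G : finZmodType) (rho eps : R)
    (hq : (2 <= q)%N) (hG : #|G| = q)
    (hrho0 : 0 < rho) (hrho1 : rho < 1 - 1 / (q ^ 2)%N%:R)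
    (heps0 : 0 < eps) (heps1 : eps < entropy (q ^ 2)%N rho) :
  (\forall n \near \oo, (codesize q n rho eps <= q ^ n)%N) /\
  (alpha G n rho (codesize q n rho eps) @[n --> \oo] --> (1 : R)).
Proof.
split.
  near=> n; apply: codesize_le; first exact: ltnW.
    by near: n; exists 1%N.
  by near: n; apply: ge_nat_near; rewrite subr_gt0.
subst q; have q1 : 1 < (#|G| ^ 2)%N%:R :> R by exact: card_sqr_gt1.
have rho1 : rho < 1.
  by apply: (lt_trans hrho1); rewrite ltrBlDr ltrDl divr_gt0 //; lra.
have [c ge_geom] := @alpha_ge_geometric R G rho eps hq
  (introT andP (conj hrho0 rho1)) heps0 heps1.
apply: (@squeeze_cvgr _ _ _ _ (fun n => 1 - geometric c #|G|%:R^-1 n) (fun=> 1)).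
- by near=> n; rewrite alpha_le1 andbT; near: n.
- rewrite -[X in _ --> X]subr0; apply: cvgB; first exact: cvg_cst.
  apply: cvg_geometric; rewrite ger0_norm ?invr_ge0 //.
  by rewrite invf_lt1 ?ltr1n // ltr0n ltnW.
- exact: cvg_cst.
Unshelve. all: by end_near.
Qed.
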